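(* Let $\alpha$ be an action of a discrete group $G$ on a locally compact Hausdorff space $X$. Let $\mathcal{F}$ be a family of subgroups of $G$ closed under conjugation and taking subgroups. Then $$\dim_{\mathrm{LTC}}(\alpha)+1\leq\left(\operatorname{eqasdim}(\alpha,\mathcal{F})+1\right)\cdot\sup_{H\in\mathcal{F}}\left(\dim_{\mathrm{LTC}}(\alpha_{|_H})+1\right).$$
   Context: $\alpha_{|_H}$ is the restriction of the action to the subgroup $H$. $\Subset$ means compact subset (finite subset in a discrete group). A family of subgroups is understood to be nonempty. For a collection $\mathcal{U}$ of subsets of a space, $\operatorname{mult}(\mathcal{U})=\sup_x|\{U\in\mathcal{U}\colon x\in U\}|$. All dimensions may be $\infty$. Equivariant asymptotic dimension: let $\Delta$ be the action of $G$ on $G\times X$ given by $\Delta_g(g',x)=(g'g^{-1},\alpha_g(x))$. $\operatorname{eqasdim}(\alpha,\mathcal{F})$ is the infimum of all nonnegative integers $d$ satisfying: for any finite $L\Subset G$ and any compact $K\Subset X$ there is a collection $\mathcal{W}$ of open sets in $G\times X$ such that (Lo) for any $x\in K$ there is $W\in\mathcal{W}$ with $L\times\{x\}\subseteq W$; (Mu) $\operatorname{mult}(\mathcal{W})\leq d+1$; (Eq) for any $W\in\mathcal{W}$ and $g\in G$, $\Delta_g(W)$ is also in $\mathcal{W}$ and is either equal to $W$ or disjoint from $W$; (St) for any $W\in\mathcal{W}$ the set stabilizer $\{g\in G\colon\Delta_g(W)=W\}$ is an element of $\mathcal{F}$. Long thin covering dimension (for an action $\alpha$ of a discrete group $G$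 on $X$): write $\alpha_L(x)=\{\alpha_g(x)\colon g\in L\}$. $\dim_{\mathrm{LTC}}(\alpha)$ is the infimum of all natural numbers $d$ satisfying: for any finite $L\Subset G$ and any compact $K\Subset X$ there is a natural number $N$ such that for any finite open cover $\mathcal{V}$ of $X$ there exist a collection $\mathcal{U}$ of open sets in $X$ and locally constant functions $\Lambda_U\colon U\to X$ ($U\in\mathcal{U}$) satisfying: (Lo) for any $x\in K$ there is $U\in\mathcal{U}$ with $\alpha_L(x)\subseteq U$; (Mu) $\operatorname{mult}(\mathcal{U})\leq d+1$; (Eq) for any $U\in\mathcal{U}$, $x\in U$, $g\in L$, if $\alpha_g(x)\in U$ then $\Lambda_U(\alpha_g(x))=\alpha_g(\Lambda_U(x))$; (Th) for any $U\in\mathcal{U}$ and $y\in\Lambda_U(U)$ there is $V\in\mathcal{V}$ with $\Lambda_U^{-1}(y)\cup\{y\}\subseteq V$; (Ca) $|\Lambda_U(U)|\leq N$ for any $U\in\mathcal{U}$. *)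

(* Defs.v *)
From HB Require Import structures.
From mathcomp Require Import all_boot all_order all_algebra.
From mathcomp Require Import all_classical all_reals all_analysis.

Set Implicit Arguments.
Unset Strict Implicit.
Unset Printing Implicit Defensive.
Import Order.TTheory GRing.Theory Num.Theory.

Local Open Scope classical_set_scope.
Local Open Scope ring_scope.
Local Open Scope group_scope.

Record subgroup (G : groupType) := Subgroup {
  subgroup_set :> set G;
  subgroup1 : subgroup_set 1;
  subgroupM : forall x y : G,
    subgroup_set x -> subgroup_set y -> subgroup_set (x * y);
  subgroupV : forall x : G, subgroup_set x -> subgroup_set x^-1 }.

(* The group H itself: the subtype {x : G | x \in H} with the operations of G. *)
Definition subgroup_type (G : groupType) (H : subgroup G) : Type :=
  set_type (subgroup_set H).

HB.instance Definition _ (G : groupType) (H : subgroup G) :=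
  SubChoice.copy (subgroup_type H) (set_type (subgroup_set H)).

Fact subgroup_group_closed (G : groupType) (H : subgroup G) :
  group_closed (fun x : G => x \in subgroup_set H).
Proof.
split=> [|x y]; rewrite -!topredE /= !inE; first exact: subgroup1.
by move=> Hx Hy; exact: (subgroupM Hx (subgroupV Hy)).
Qed.

HB.instance Definition _ (G : groupType) (H : subgroup G) :=
  @SubChoice_isSubGroup.Build G (fun x : G => x \in subgroup_set H)
    (subgroup_type H) (@subgroup_group_closed G H).

(* Left action of the discrete group G on X by homeomorphisms; continuity of
   the inverse of [act g] follows from that of [act g^-1]. *)
Record action (G : groupType) (X : topologicalType) := Action {
  act :> G -> X -> X;
  act1 : forall x, act 1 x = x;
  actM : forall g h x, act (g * h) x = act g (act h x);
  act_continuous : forall g, continuous (act g) }.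

Section Restriction.
Context (G : groupType) (X : topologicalType).
Variables (alpha : action G X) (H : subgroup G).

Let act_res (h : subgroup_type H) (x : X) : X := alpha (val h) x.

Fact act_res1 x : act_res 1 x = x.
Proof. exact: act1. Qed.

Fact act_resM g h x : act_res (g * h) x = act_res g (act_res h x).
Proof. exact: actM. Qed.

Fact act_res_continuous h : continuous (act_res h).
Proof. exact: act_continuous. Qed.

Definition restrict_action : action (subgroup_type H) X :=
  Action act_res1 act_resM act_res_continuous.
End Restriction.

Definition closed_under_conjugation (G : groupType) (F : set (subgroup G)) :=
  forall (H K : subgroup G) (g : G), F H ->
    K = [set x ^ g | x in H] :> set G -> F K.

Definition closed_under_subgroups (G : groupType) (F : set (subgroup G)) :=
  forall H K : subgroup G, F H -> K `<=` H -> F K.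

(* The supremum of the cardinalities, in the extended reals; it is -oo rather
   than 0 when T is empty, which is immaterial for upper bounds. *)
Definition mult (R : realType) (T : Type) (UU : set (set T)) : \bar R :=
  ereal_sup (range (fun x : T => counting [set U | UU U /\ U x])).

Definition locally_constant_on (X : topologicalType) (Y : Type) (U : set X)
    (f : X -> Y) :=
  forall x, U x -> \forall y \near x, U y -> f y = f x.

Section EquivariantAsymptoticDimension.
Context (G : groupType) (X : topologicalType).
Variables (alpha : action G X) (F : set (subgroup G)).

Local Notation GX := (discrete_topology G * X)%type.

Definition Delta (g : G) (p : GX) : GX := ((p.1 : G) * g^-1, alpha g p.2).

Definition set_stabilizer (W : set GX) : set G := [set g | Delta g @` W = W].

Definition eqasdim_admissible (R : realType) (d : nat) :=
  forall (L : set G) (K : set X), finite_set L -> compact K ->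
  exists WW : set (set GX),
    [/\ forall W, WW W -> open W,
        forall x, K x -> exists2 W, WW W & L `*` [set x] `<=` W,
        (mult R WW <= d.+1%:R%:E)%E,
        forall W g, WW W ->
          WW (Delta g @` W) /\
          (Delta g @` W = W \/ Delta g @` W `&` W = set0) &
        forall W, WW W ->
          exists2 H : subgroup G, F H & H = set_stabilizer W :> set G].

(* The infimum of the empty set is +oo. *)
Definition eqasdim (R : realType) : \bar R :=
  ereal_inf [set d%:R%:E | d in eqasdim_admissible R].
End EquivariantAsymptoticDimension.

Section LongThinCoveringDimension.
Context (G : groupType) (X : topologicalType).
Variable alpha : action G X.

Definition finite_open_cover (VV : set (set X)) :=
  [/\ finite_set VV, forall V, VV V -> open V &
      \bigcup_(V in VV) V = [set: X]].

(* The function Lambda_U : U -> X is represented by a total function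
   [Lam U : X -> X], only the values of which on U matter. *)
Definition ltc_admissible (R : realType) (d : nat) :=
  forall (L : set G) (K : set X), finite_set L -> compact K ->
  exists N : nat, forall VV : set (set X), finite_open_cover VV ->
  exists (UU : set (set X)) (Lam : set X -> X -> X),
    [/\ forall U, UU U -> open U /\ locally_constant_on U (Lam U),
        forall x, K x -> exists2 U, UU U & [set alpha g x | g in L] `<=` U,
        (mult R UU <= d.+1%:R%:E)%E &
      [/\ forall U x g, UU U -> U x -> L g -> U (alpha g x) ->
            Lam U (alpha g x) = alpha g (Lam U x),
          forall U y, UU U -> (Lam U @` U) y ->
            exists2 V, VV V & (U `&` Lam U @^-1` [set y]) `|` [set y] `<=` V &
          forall U, UU U -> (Lam U @` U #<= `I_N)%card]].

Definition dimLTC (R : realType) : \bar R :=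
  ereal_inf [set d%:R%:E | d in ltc_admissible R].
End LongThinCoveringDimension.

(* Main.v *)
Require Import Defs.
From mathcomp Require Import all_boot all_order all_algebra.
From mathcomp Require Import all_classical all_reals all_analysis.

Set Implicit Arguments.
Unset Strict Implicit.
Local Open Scope classical_set_scope.
Import Order.TTheory GRing.Theory Num.Theory.

(* The sets in an equivariant cover W of G x X come in G-orbits, and the orbit
   of B is G-equivariantly a disjoint union indexed by G/H, where H is the
   stabilizer of B. Slicing over 1 in G and transporting by coset
   representatives, a long thin cover for the action of H is induced to one for
   the action of G. Only the sets of the orbits of finitely many members of W,
   covering K, are needed, which makes the coset representatives, the finite
   subsets of the stabilizers and the cardinalities N uniformly bounded. At a
   point z at most d+1 members of W contain (1, z), and each contributes at
   most D+1 sets, where D bounds the dimensions of the restrictions to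
   stabilizers. A fibre of the induced map is a union of pieces over several
   cosets, each only small separately, so the given cover is first replaced by
   a star refinement near a compact set; this is where X being locally compact
   Hausdorff enters. *)

(** * Compactness, closed shrinkings and refinements of open covers *)

Section Topology.
Context (X : topologicalType).
Implicit Types (A B C K : set X) (VV WW : set (set X)).

(** If [P K] failed, the complements in [K] of sets satisfying [P] would generate a proper filter;
    the neighbourhood with [P] at a cluster point contradicts clustering. *)
Lemma compact_ind (P : set X -> Prop) K :
  P set0 -> (forall A B, P A -> P B -> P (A `|` B)) ->
  (forall A B, A `<=` B -> P B -> P A) ->
  (forall x, K x -> exists2 A, nbhs x A & P A) ->
  compact K -> P K.
Proof.
move=> P0 PU PS Ploc cK; apply: contrapT => nPK.
pose F : set_system X := [set S | exists2 A, P A & K `\` A `<=` S].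
have FF : ProperFilter F.
  split=> [[A PA KA]|].
    apply: nPK; apply: (PS _ A) => // x Kx; apply: contrapT => nAx.
    exact: (KA x).
  split=> [|S T [A PA KA] [B PB KB]|S T ST [A PA KA]].
  - by exists set0.
  - exists (A `|` B); first exact: PU.
    move=> x [Kx nAB]; split; [apply: KA|apply: KB]; split=> // ?; apply: nAB.
    + by left.
    + by right.
  - by exists A => //; exact: (subset_trans KA).
have FK : F K by exists set0 => // x [].
have [x [Kx clx]] := cK F FF FK.
have [A nA PA] := Ploc x Kx.
have FA : F (K `\` A) by exists A.
by have [y [[_ nAy] Ay]] := clx _ _ FA nA.
Qed.

Lemma compact_sub_interior K : locally_compact [set: X] -> compact K ->
  exists2 C, compact C & K `<=` C°.
Proof.
move=> lcX; apply: (@compact_ind (fun A => exists2 C, compact C & A `<=` C°)).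
- by exists set0 => //; exact: compact0.
- move=> A B [C cC AC] [D cD BD]; exists (C `|` D); first exact: compactU.
  move=> x [/AC|/BD]; apply: interiorS => y ?; [by left|by right].
- by move=> A B AB [C cC BC]; exists C => //; exact: subset_trans BC.
- move=> x _; have [C] := lcX x I; rewrite withinET => nC [cC _].
  exists C°; first exact: nbhs_interior.
  by exists C.
Qed.

(** Regularity gives each point of [K] a closed neighbourhood inside one member; [compact_ind] glues
    these by unions taken member by member. *)
Lemma compact_closed_shrinking K VV :
  locally_compact [set: X] -> hausdorff_space X -> compact K ->
  (forall V, VV V -> open V) -> K `<=` \bigcup_(V in VV) V ->
  exists F : set X -> set X, [/\ forall V, closed (F V),
    forall V, F V `<=` V & K `<=` \bigcup_(V in VV) F V].
Proof.
move=> lcX hX cK oV KV; pose P A := exists F : set X -> set X,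
  [/\ forall V, closed (F V), forall V, F V `<=` V &
      A `<=` \bigcup_(V in VV) F V].
apply: (@compact_ind P) => // {cK}.
- by exists (fun=> set0); split=> // V; [exact: closed0|exact: sub0set].
- move=> A B [F [cF sF AF]] [E [cE sE BE]];
  exists (fun V => F V `|` E V); split.
  + by move=> V; exact: closedU.
  + by move=> V x [/sF|/sE].
  + by move=> x [/AF|/BE] [V VV_ ?]; exists V => //; [left|right].
- by move=> A B AB [F [cF sF BF]]; exists F; split=> //; exact: subset_trans BF.
move=> x /KV [V VVV Vx].
have [C] := lcX x I; rewrite withinET => nC [cC _].
have [B nB BV] :=
  compact_regular hX cC nC (open_nbhs_nbhs (conj (oV _ VVV) Vx)).
exists B => //; exists (fun W => if W == V then closure B else set0).
split=> [W|W|y By].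
- by case: ifP => _; [exact: closed_closure|exact: closed0].
- by case: ifP => [/eqP ->|_]; [exact: BV|exact: sub0set].
- by exists V => //; rewrite eqxx; exact: subset_closure.
Qed.

Lemma common_refinement (I : eqType) (D : set I) (VV : I -> set (set X)) :
  finite_set D -> (forall i, D i -> finite_open_cover (VV i)) ->
  exists2 WW, finite_open_cover WW &
    forall W i, WW W -> D i -> exists2 V, VV i V & W `<=` V.
Proof.
move=> /finite_seqP [s ->]; elim: s => [_|i s IHs cV].
  exists [set setT] => //; split=> //.
  - by move=> V ->; exact: openT.
  - by rewrite bigcup_set1.
have [j js|WW [fW oW cW] rW] := IHs.
  by apply: cV; rewrite /= in_cons js orbT.
have [|fV oV cVi] := cV i; first by rewrite /= mem_head.
exists [set W `&` V | W in WW & V in VV i].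
  split.
  - exact: finite_image2.
  - by move=> _ [W WW_ [V VV_ <-]]; apply: openI; [exact: oW|exact: oV].
  - rewrite -subTset => x _.
    have [W WW_ Wx] : (\bigcup_(W in WW) W) x by rewrite cW.
    have [V VV_ Vx] : (\bigcup_(V in VV i) V) x by rewrite cVi.
    by exists (W `&` V) => //; exists W => //; exists V.
move=> _ j [W WW_ [V VV_ <-]]; rewrite /= in_cons => /orP[/eqP ->|js].
  by exists V.
have [V' VV' WV'] := rW W j WW_ js.
by exists V' => // x [/WV'].
Qed.

Lemma finite_open_cover2 A B : open A -> open B -> A `|` B = setT ->
  finite_open_cover [set A; B].
Proof.
move=> oA oB AB; split; first exact: finite_set2.
- by move=> _ [->|->].
- by rewrite -AB bigcup_setU !bigcup_set1.
Qed.

(* A barycentric refinement near a compact set; X itself need not be normal. *)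
Lemma compact_star_refinement C VV :
  locally_compact [set: X] -> hausdorff_space X -> compact C ->
  finite_open_cover VV ->
  exists2 WW, finite_open_cover WW &
    forall W0 x, WW W0 -> W0 x -> W0 `&` C !=set0 ->
    exists2 V, VV V &
      forall W, WW W -> W x -> W `&` C !=set0 -> W `<=` V.
Proof.
move=> lcX hX cC [fV oV cV].
have [C2 cC2 CC2] := compact_sub_interior lcX cC.
have [|F [cF sF C2F]] := compact_closed_shrinking lcX hX cC2 oV.
  by rewrite cV.
have [|WW1 [fW1 oW1 cW1] rW1] :=
    @common_refinement _ VV (fun V => [set V; ~` F V]) fV.
  move=> V VV_; apply: finite_open_cover2; first exact: oV.
    by rewrite openC.
  by rewrite -subTset => x _; have [/sF|] := pselect (F V x); [left|right].
have cov2 : finite_open_cover [set C2°; ~` C].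
  apply: finite_open_cover2; first exact: open_interior.
    by rewrite openC; exact: compact_closed.
  by rewrite -subTset => x _; have [/CC2|] := pselect (C x); [left|right].
have [|WW cW rW] := @common_refinement _ [set true; false]
    (fun b => if b then WW1 else [set C2°; ~` C]) (finite_set2 _ _).
  by move=> [] _.
exists WW => // W0 x WW0 W0x [y [W0y Cy]].
(* [W0] meets [C], so it lies in [C2] and [x] is in some [F V]. A member through [x] then cannot lie
   in the complement of [F V], and must lie in [V]. *)
have [V VVV FVx] : (\bigcup_(V in VV) F V) x.
  have [_ [->|->] W0C] := rW W0 false WW0 (or_intror erefl).
    by apply: C2F; apply: interior_subset; exact: W0C.
  by have := W0C _ W0y.
exists V => // W WW_ Wx _.
have [W1 WW1_ WW1s] := rW W true WW_ (or_introl erefl).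
have [_ [->|->] W1V] := rW1 W1 V WW1_ VVV.
  exact: subset_trans W1V.
by have := W1V _ (WW1s _ Wx).
Qed.

End Topology.

(** * Counting with lists, and infima of sets of naturals *)

Lemma card_le_IP (T : choiceType) (A : set T) n :
  (A #<= `I_n)%card <-> exists2 s : seq T, (size s <= n)%N & A `<=` [set` s].
Proof.
split=> [An|[s sn As]].
  have fA : finite_set A by apply/finite_set_leP; exists n.
  exists (finmap.enum_fset (fset_set A)); first exact: geq_card_fset_set.
  by move=> x Ax /=; rewrite [_ \in _]in_fset_set// inE.
have [-> |/set0P[x0 _]] := eqVneq A set0; first exact: card_ge0.
apply: (card_le_trans (subset_card_le As)).
apply: (@card_le_trans _ _ _ `I_(size s)); last by rewrite card_le_II.
apply: (card_le_trans _ (card_image_le (nth x0 s) `I_(size s))).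
apply: subset_card_le => x /= xs; exists (index x s); last exact: nth_index.
by rewrite /= index_mem.
Qed.

(** Since [counting] is [+oo] on infinite sets, the bound yields enumerations; multiplicities can
    then be multiplied as list sizes. *)
Lemma mult_leP (R : realType) (T : Type) (UU : set (set T)) n :
  (mult R UU <= n%:R%:E)%E <->
  forall x, exists2 s : seq (set T), (size s <= n)%N &
    forall U, UU U -> U x -> U \in s.
Proof.
have countP (A : set (set T)) :
    (counting A <= (n%:R%:E : \bar R))%E <-> (A #<= `I_n)%card.
  rewrite /counting; case: asboolP => fA; last first.
    split=> [|An]; first by rewrite leNgt ltry.
    by exfalso; apply: fA; apply/finite_set_leP; exists n.
  rewrite lee_fin ler_nat; split=> [An|]; last exact: geq_card_fset_set.
  apply/card_le_IP; exists (finmap.enum_fset (fset_set A)) => // x Ax /=.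
  by rewrite [_ \in _]in_fset_set// inE.
split=> [/ereal_supP UUn x|UUn].
  have /countP/card_le_IP[s sn As] := UUn _ (ex_intro2 _ _ x I erefl).
  by exists s => // U UUU Ux; exact: As.
apply/ereal_supP => _ [x _ <-]; apply/countP/card_le_IP.
by have [s sn As] := UUn x; exists s => // U [UUU Ux]; exact: As.
Qed.

(** By well-ordering, a finite dimension is itself admissible. *)
Lemma ereal_inf_nat (R : realType) (P : set nat) :
  ereal_inf [set (d%:R%:E : \bar R) | d in P] = +oo%E \/
  exists2 d, P d & ereal_inf [set (d%:R%:E : \bar R) | d in P] = d%:R%:E.
Proof.
have [->|/set0P[d0 Pd0]] := eqVneq P set0.
  by left; rewrite image_set0 ereal_inf0.
have exP : exists d, `[< P d >] by exists d0; apply/asboolP.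
right; case: (ex_minnP exP) => d /asboolP Pd dmin; exists d => //.
apply/eqP; rewrite eq_le; apply/andP; split.
  by apply: ereal_inf_lbound; exists d.
apply/ereal_infP => _ [e Pe <-]; rewrite lee_fin ler_nat.
by apply: dmin; apply/asboolP.
Qed.

Lemma size_allpairs_dep_leq (S T : eqType) (U : Type) (f : S -> T -> U)
    (s : seq S) (t : S -> seq T) m n :
  (size s <= m)%N -> (forall x, x \in s -> (size (t x) <= n)%N) ->
  (size [seq f x y | x <- s, y <- t x] <= m * n)%N.
Proof.
move=> sm tn; apply: (@leq_trans (size s * n)); last first.
  by rewrite leq_mul2r sm orbT.
rewrite size_allpairs_dep; elim: s {sm} tn => //= x s IHs tn.
rewrite mulSn leq_add ?tn ?mem_head// IHs// => y ys.
by apply: tn; rewrite in_cons ys orbT.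
Qed.

Lemma open_finite_bigcap (X : topologicalType) (I : eqType) (D : set I)
    (A : I -> set X) :
  finite_set D -> (forall i, D i -> open (A i)) -> open (\bigcap_(i in D) A i).
Proof.
move=> /finite_seqP [s ->]; elim: s => [_|i s IHs oA].
  suff -> : \bigcap_(i in [set` [::]]) A i = setT by exact: openT.
  by rewrite -subTset => x _ i.
have -> : \bigcap_(j in [set` i :: s]) A j =
    A i `&` \bigcap_(j in [set` s]) A j.
  apply/seteqP; split=> [x Ax|x [Aix Ax] j].
    by split=> [|j js]; apply: Ax; rewrite /= in_cons ?eqxx// [_ \in _]js orbT.
  by rewrite /= in_cons => /orP[/eqP ->|/Ax].
apply: openI.
  by apply: oA; rewrite /= mem_head.
by apply: IHs => j js; apply: oA; rewrite /= in_cons js orbT.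
Qed.

(** * Orbits of sets under [Delta] and coset representatives *)

Section Orbits.
Local Open Scope group_scope.
Context (G : groupType) (X : topologicalType) (alpha : action G X).
Local Notation GX := (discrete_topology G * X)%type.
Local Notation Dl := (Delta alpha).
Implicit Types (W : set GX) (g h : G).

Lemma actK g : cancel (alpha g) (alpha g^-1).
Proof. by move=> x; rewrite -actM mulVg act1. Qed.

Lemma actKV g : cancel (alpha g^-1) (alpha g).
Proof. by move=> x; rewrite -actM mulgV act1. Qed.

Lemma Delta_image1 W : Dl 1 @` W = W.
Proof.
have D1 p : Dl 1 p = p by case: p => k x; rewrite /Delta /= act1 invg1 mulg1.
by apply/seteqP; split=> [_ [p Wp <-]|p Wp]; [rewrite D1|exists p].
Qed.

Lemma Delta_imageM g h W : Dl (g * h) @` W = Dl g @` (Dl h @` W).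
Proof.
rewrite image_comp; apply: eq_imagel => -[k x] _.
by rewrite /Delta /= actM invgM mulgA.
Qed.

Lemma Delta_imageE g W k x : (Dl g @` W) (k, x) <-> W (k * g, alpha g^-1 x).
Proof.
split=> [[[h y] Why [<- <-]]|Wkx]; first by rewrite mulgVK actK.
by exists (k * g, alpha g^-1 x) => //; rewrite /Delta /= mulgK actKV.
Qed.

(** Chosen from the orbit as a set, hence the same for all its members. The default is never taken,
    as orbits are nonempty. *)
Definition orbit_rep W : set GX := xget set0 [set Dl g @` W | g in setT].

(** Represents the coset of the stabilizer of [orbit_rep W] that corresponds to [W]. *)
Definition orbit_elt W : G := xget 1 [set g | Dl g @` orbit_rep W = W].

Lemma orbit_rep_Delta g W : orbit_rep (Dl g @` W) = orbit_rep W.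
Proof.
congr xget; apply/seteqP; split=> _ [h _ <-].
  by exists (h * g) => //; rewrite Delta_imageM.
by exists (h * g^-1) => //; rewrite -Delta_imageM mulgVK.
Qed.

Lemma orbit_eltP W : Dl (orbit_elt W) @` orbit_rep W = W.
Proof.
have [g _ gW] : [set Dl g @` W | g in setT] (orbit_rep W).
  by apply: xgetPex; exists (Dl 1 @` W), 1.
apply: (@xgetPex _ 1 [set g | Dl g @` orbit_rep W = W]); exists g^-1 => /=.
by rewrite -gW -Delta_imageM mulVg Delta_image1.
Qed.

Lemma orbit_repE W : orbit_rep W = Dl (orbit_elt W)^-1 @` W.
Proof.
have := congr1 (fun S => Dl (orbit_elt W)^-1 @` S) (orbit_eltP W).
by rewrite /= -Delta_imageM mulVg Delta_image1.
Qed.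

(** The product moves the representative to [W1], then to [W2], then back: it is the action of [g]
    read through the coset representatives. *)
Lemma orbit_elt_stabilizer g W1 W2 :
  orbit_rep W1 = orbit_rep W2 -> Dl g @` W1 = W2 ->
  set_stabilizer alpha (orbit_rep W1) ((orbit_elt W2)^-1 * g * orbit_elt W1).
Proof.
move=> r12 gW; rewrite /set_stabilizer /= !Delta_imageM orbit_eltP gW.
by rewrite r12 orbit_repE.
Qed.

Lemma open_slice g W : open W -> open [set z | W (g, z)].
Proof.
move=> oW; have : continuous (fun z : X => (g, z) : GX).
  move=> z S [[A B] /= [nA nB] AB]; apply: filterS nB => y By.
  by apply: AB; split=> //; exact: nbhs_singleton nA.
by move=> /continuousP; exact.
Qed.

(* If z is in the core of W and alpha_l z in that of W', with W and W' in the
   same orbit, then (l^-1, alpha_l z) lies in both Delta_l W and W', so that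
   these coincide: this is what makes [piece_map] below equivariant. *)
Definition core (L : set G) W : set X :=
  [set z | W (1, z) /\ forall l, L l -> W (l^-1, z)].

Lemma open_core L W : finite_set L -> open W -> open (core L W).
Proof.
move=> fL oW.
suff -> : core L W = [set z | W (1, z)] `&`
    \bigcap_(l in L) [set z | W (l^-1, z)].
  apply: openI; first exact: open_slice.
  by apply: open_finite_bigcap => // l _; exact: open_slice.
by [].
Qed.
End Orbits.

(** * Inducing one set and its map from a stabilizer to [G] *)

Section Piece.
Local Open Scope group_scope.
Context (G : groupType) (X : topologicalType) (alpha : action G X).
Local Notation GX := (discrete_topology G * X)%type.
Local Notation Dl := (Delta alpha).
Local Notation rep := (orbit_rep alpha).
Local Notation elt := (orbit_elt alpha).
Context (WW WW1 : set (set GX)).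
Hypothesis WW_eq : forall W g, WW W ->
  WW (Dl g @` W) /\ (Dl g @` W = W \/ Dl g @` W `&` W = set0).
Hypothesis WW1_sub : WW1 `<=` WW.

(** [W'] is a translate of [W], so the dichotomy in [WW_eq] applies. Thus at most one member of each
    orbit contains [(1, z)]. *)
Lemma same_orbit_meet W W' :
  WW W -> rep W = rep W' -> W `&` W' !=set0 -> W = W'.
Proof.
move=> WWW rW [p [Wp W'p]].
have W'E : W' = Dl (elt W' * (elt W)^-1) @` W.
  by rewrite Delta_imageM -orbit_repE rW orbit_eltP.
have [_ [<-//|WW'0]] := WW_eq (elt W' * (elt W)^-1) WWW.
by exfalso; have : (W' `&` W) p by []; rewrite {1}W'E WW'0.
Qed.

Context (L : set G) (O : set X) (B : set GX) (V : set X) (lam : X -> X).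

(* With H the stabilizer of B, the slice over 1 of the union of the orbit of B
   is a disjoint union of parts indexed by the cosets gH, each identified
   through alpha_g^-1 with a subset of the H-space X.  [V] and [lam] are
   transported along these identifications. *)
Definition piece : set X := [set z | O z /\ exists W,
  [/\ WW1 W, rep W = B, core L W z & V (alpha (elt W)^-1 z)]].

(** Unambiguous by [same_orbit_meet]; the default can occur only outside [piece]. *)
Definition piece_index (z : X) : set GX :=
  xget set0 [set W | [/\ WW1 W, rep W = B & W (1, z)]].

Definition piece_map (z : X) : X :=
  let g := elt (piece_index z) in alpha g (lam (alpha g^-1 z)).

Lemma piece_indexE z W : WW1 W -> rep W = B -> W (1, z) -> piece_index z = W.
Proof.
move=> W1 rW Wz.
have [W1' rW' Wz'] := @xgetPex _ set0 [set W | [/\ WW1 W, rep W = B & W (1, z)]]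
  (ex_intro _ W (And3 W1 rW Wz)).
apply: same_orbit_meet; first exact: WW1_sub.
  by rewrite rW.
by exists (1, z).
Qed.

Lemma pieceP z : piece z -> [/\ O z, WW1 (piece_index z),
  rep (piece_index z) = B, core L (piece_index z) z &
  V (alpha (elt (piece_index z))^-1 z)].
Proof.
move=> [Oz [W [W1 rW cW VW]]].
by have -> : piece_index z = W by apply: piece_indexE => //; case: cW.
Qed.

Lemma open_piece :
  finite_set L -> (forall W, WW W -> open W) -> open O -> open V -> open piece.
Proof.
move=> fL oW oO oV.
suff -> : piece = O `&` \bigcup_(W in [set W | WW1 W /\ rep W = B])
    (core L W `&` alpha (elt W)^-1 @^-1` V).
  apply: openI => //; apply: bigcup_open => W [W1 _]; apply: openI.
    by apply: open_core => //; apply: oW; exact: WW1_sub.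
  by move: (@act_continuous _ _ alpha (elt W)^-1) => /continuousP; exact.
apply/seteqP; split=> z.
  by move=> [Oz [W [W1 rW cW VW]]]; split=> //; exists W.
by move=> [Oz [W [W1 rW] [cW VW]]]; split=> //; exists W.
Qed.

(** The index is constant on the open set [core L W], so near [x] a single coset representative
    enters. *)
Lemma locally_constant_piece : finite_set L -> (forall W, WW W -> open W) ->
  locally_constant_on V lam -> locally_constant_on piece piece_map.
Proof.
move=> fL oW lV x px; have [_] := pieceP px.
rewrite /piece_map; set W := piece_index x => W1 rW cW Vx.
have nC : nbhs x (core L W).
  apply: open_nbhs_nbhs; split=> //.
  by apply: open_core => //; apply: oW; exact: WW1_sub.
have nV := @act_continuous _ _ alpha (elt W)^-1 x _ (lV _ Vx).
near=> y => py.
have yW : piece_index y = W.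
  apply: piece_indexE => //.
  have : core L W y by near: y.
  by case.
have [_ _ _ _] := pieceP py; rewrite yW => Vy; congr (alpha _ _).
move: Vy; near: y; exact: nV.
Unshelve. all: by end_near. Qed.

(** The cores force [l] to carry the index of [x] to that of [alpha l x]. Pulled back by the
    representatives, [l] becomes the stabilizer element [h], for which [lam] is equivariant. *)
Lemma piece_map_equivariant l x :
  (forall h y, set_stabilizer alpha B h ->
    (exists2 W, WW1 W & exists2 W', WW1 W' & h = (elt W')^-1 * l * elt W) ->
    V y -> V (alpha h y) -> lam (alpha h y) = alpha h (lam y)) ->
  L l -> piece x -> piece (alpha l x) ->
  piece_map (alpha l x) = alpha l (piece_map x).
Proof.
move=> lamE Ll /pieceP [_ W1 rW [Wx _] Vx] /pieceP [_].
rewrite /piece_map; move: W1 rW Wx Vx.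
set W := piece_index x; set W' := piece_index (alpha l x).
move=> W1 rW Wx Vx W1' rW' [_ W'x] V'x.
have lW : Dl l @` W = W'.
  apply: same_orbit_meet; first by case: (WW_eq l (WW1_sub W1)).
    by rewrite orbit_rep_Delta rW rW'.
  exists (l^-1, alpha l x); split; last exact: W'x.
  by apply/Delta_imageE; rewrite mulVg actK.
pose h := (elt W')^-1 * l * elt W.
have hE : alpha (elt W')^-1 (alpha l x) = alpha h (alpha (elt W)^-1 x).
  by rewrite -!actM /h mulgK.
rewrite hE lamE; first by rewrite -!actM /h !mulgA mulgV mul1g.
- by rewrite -rW; apply: orbit_elt_stabilizer; rewrite ?rW.
- by exists W => //; exists W'.
- exact: Vx.
- by rewrite -hE.
Qed.

(** [Q] depends on [x]: points of one fibre may have different indices, and their sets [Q] are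
    united later by the star refinement. *)
Lemma piece_map_small (VH SS : set (set X)) x :
  (forall y, (lam @` V) y ->
    exists2 S, VH S & (V `&` lam @^-1` [set y]) `|` [set y] `<=` S) ->
  (forall S g, VH S -> (elt @` WW1) g ->
    exists2 Q, SS Q & S `<=` alpha g @^-1` Q) ->
  piece x -> exists2 Q, SS Q & Q x /\ Q (piece_map x).
Proof.
move=> lamT VHs /pieceP [_]; rewrite /piece_map.
set W := piece_index x => W1 rW _ Vx.
pose y := alpha (elt W)^-1 x.
have [S VHS yS] := lamT (lam y) (ex_intro2 _ _ y Vx erefl).
have [Q SSQ SQ] := VHs S (elt W) VHS (ex_intro2 _ _ W W1 erefl).
exists Q => //; split.
  by rewrite -(actKV alpha (elt W) x); apply: (SQ y); apply: yS; left.
by apply: (SQ (lam y)); apply: yS; right.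
Qed.

Lemma card_piece_map (s : seq G) n :
  elt @` WW1 `<=` [set` s] -> (lam @` V #<= `I_n)%card ->
  (piece_map @` piece #<= `I_(size s * n))%card.
Proof.
move=> sW /card_le_IP [r rn lr]; apply/card_le_IP.
exists [seq alpha g y | g <- s, y <- r].
  by rewrite size_allpairs leq_mul2l rn orbT.
move=> _ [x /pieceP [_ W1 _ _ Vx] <-] /=; apply/allpairsP.
exists (elt (piece_index x), lam (alpha (elt (piece_index x))^-1 x)) => /=.
split=> //; [apply: sW|apply: lr]; last by eexists; first exact: Vx.
by exists (piece_index x).
Qed.
End Piece.

(** * Assembling the induced covers over finitely many orbits *)

Section StabilizerCovers.
Context (R : realType) (G : groupType) (X : topologicalType).
Context (alpha : action G X) (F : set (subgroup G)).
Local Notation GX := (discrete_topology G * X)%type.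
Local Notation Dl := (Delta alpha).
Local Notation rep := (orbit_rep alpha).
Local Notation elt := (orbit_elt alpha).

Lemma compact_bigcup_act (I : choiceType) (T : set I) (f : I -> G) K :
  finite_set T -> compact K -> compact (\bigcup_(a in T) alpha (f a) @` K).
Proof.
move=> fT cK; rewrite -bigsetU_fset_set//; apply: bigsetU_compact => a _.
apply: continuous_compact => //; apply: continuous_subspaceT.
exact: act_continuous.
Qed.

(* The long thin cover conditions for the action of the stabilizer of B, stated
   with elements of G instead of elements of the subtype; the finite subset of
   the stabilizer consists of the elements of T^-1 L T lying in it. *)
Definition stabilizer_ltc (B : set GX) (e : nat) (T L : set G) (K : set X)
    (N : nat) (VV UU : set (set X)) (lam : set X -> X -> X) :=
  let shift h l := set_stabilizer alpha B h /\
    exists2 a, T a & exists2 b, T b & h = (a^-1 * l * b)%g in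
  [/\ forall V, UU V -> open V /\ locally_constant_on V (lam V),
      forall x (h : G -> G), K x -> (forall l, L l -> shift (h l) l) ->
        exists2 V, UU V & forall l, L l -> V (alpha (h l) x),
      forall x, exists2 s : seq (set X), (size s <= e.+1)%N &
        forall V, UU V -> V x -> V \in s &
    [/\ forall V l h x, UU V -> L l -> shift h l ->
          V x -> V (alpha h x) -> lam V (alpha h x) = alpha h (lam V x),
        forall V y, UU V -> (lam V @` V) y ->
          exists2 S, VV S & (V `&` lam V @^-1` [set y]) `|` [set y] `<=` S &
        forall V, UU V -> (lam V @` V #<= `I_N)%card]].

(** [LH] is finite as the preimage of a finite set under the injective [val]; as [H] is the
    stabilizer, each shift lifts to the subtype. *)
Lemma stabilizer_ltcP (H : subgroup G) (B : set GX) e (T L : set G) K :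
  subgroup_set H = set_stabilizer alpha B -> finite_set T -> finite_set L ->
  compact K -> ltc_admissible (restrict_action alpha H) R e ->
  exists N : nat, forall VV, finite_open_cover VV ->
    exists UU lam, stabilizer_ltc B e T L K N VV UU lam.
Proof.
move=> HB fT fL cK ltcH.
pose LH : set (subgroup_type H) := [set h | exists2 l, L l &
  exists2 a, T a & exists2 b, T b & val h = (a^-1 * l * b)%g].
have fLH : finite_set LH.
  have -> : LH = val @^-1` [set p.1 * p.2 |
      p in [set a^-1 * l | a in T & l in L]%g `*` T]%g.
    apply/seteqP; split.
      move=> h [l Ll [a Ta [b Tb hE]]]; exists ((a^-1 * l)%g, b) => //.
      by split=> //; exists a => //; exists l.
    move=> h [[c b] [[a Ta [l Ll /= cE]] /= Tb] hE].
    exists l => //; exists a => //; exists b => //; rewrite cE.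
    exact: esym hE.
  apply: finite_preimage; first by move=> h h' _ _; exact: val_inj.
  by apply: finite_image; apply: finite_setX => //; exact: finite_image2.
have [N ltcN] := ltcH LH K fLH cK; exists N => VV /ltcN.
move=> [UU [lam [UUo UUL /mult_leP UUm [UUe UUt UUc]]]].
have inH g : set_stabilizer alpha B g ->
    exists h : subgroup_type H, val h = g.
  rewrite -HB => Hg.
  by exists (exist _ g (mem_set Hg)).
exists UU, lam; split=> //.
  move=> x h Kx hT; have [V UUV LHV] := UUL x Kx; exists V => // l Ll.
  have [/inH [k kh] [a Ta [b Tb hE]]] := hT l Ll.
  apply: LHV; exists k; last by rewrite /= -kh.
  by exists l => //; exists a => //; exists b; rewrite ?kh.
split=> // V l h x UUV Ll [Bh hT] Vx Vhx.
have [k kh] := inH h Bh.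
have := UUe V x k UUV Vx; rewrite /= kh; apply => //.
by exists l => //; move: hT; rewrite -kh.
Qed.

Lemma ltc_admissible_mul d e :
  locally_compact [set: X] -> hausdorff_space X -> F !=set0 ->
  eqasdim_admissible alpha F R d ->
  (forall H, F H -> ltc_admissible (restrict_action alpha H) R e) ->
  ltc_admissible alpha R (d.+1 * e.+1).-1.
Proof.
move=> lcX hX [H0 FH0] eqd ltcF L K fL cK.
(* For [alpha l x] to lie in the core of the translate of [W] by [l], [W] must contain [(l, x)] and
   all [(l'^-1 * l, x)] with [l'] in [L]. *)
pose L' := L `|` [set (l^-1 * l')%g | l in L & l' in L].
have fL' : finite_set L'.
  by rewrite finite_setU; split=> //; exact: finite_image2.
have [WW [WWo WWL /mult_leP WWm WWe WWst]] := eqd L' K fL' cK.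
have [W0 [fW0 W0s KW0]] : exists W0, [/\ finite_set W0, W0 `<=` WW &
    forall x, K x -> exists2 W, W0 W & forall l, L' l -> W (l, x)].
  apply: (@compact_ind _ (fun A => exists W0, [/\ finite_set W0, W0 `<=` WW &
    forall x, A x -> exists2 W, W0 W & forall l, L' l -> W (l, x)])) => //.
  - by exists set0; split=> //; exact: sub0set.
  - move=> A A' [W0 [fW0 W0s AW0]] [W0' [fW0' W0s' AW0']].
    exists (W0 `|` W0'); split; first by rewrite finite_setU.
      by move=> W [/W0s|/W0s'].
    by move=> x [/AW0|/AW0'] [W WW_ Wx]; exists W => //; [left|right].
  - move=> A A' AA' [W0 [fW0 W0s AW0]]; exists W0; split=> // x /AA'.
    exact: AW0.
  - move=> x Kx; have [W WWW Wx] := WWL x Kx.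
    exists (\bigcap_(l in L') [set y | W (l, y)]).
      apply: open_nbhs_nbhs; split; last by move=> l Ll; exact: Wx.
      by apply: open_finite_bigcap => // l _; apply: open_slice; exact: WWo.
    exists [set W]; split; first exact: finite_set1.
      by move=> _ ->.
    by move=> y Wy; exists W.
(* [W1] supplies the indices of the points [alpha l x], [T] all coset representatives that occur,
   and [K'] the points of [K] pulled back by them. *)
pose W1 := [set Dl l @` W | l in L & W in W0].
have W1s : W1 `<=` WW.
  by move=> _ [l _ [W /W0s WWW <-]]; have [] := WWe W l WWW.
pose T := elt @` (W0 `|` W1).
have fT : finite_set T.
  apply: finite_image; rewrite finite_setU; split=> //; exact: finite_image2.
pose K' := \bigcup_(a in T) alpha a^-1%g @` K.
have cK' : compact K' by exact: compact_bigcup_act.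
have repW W : WW W -> WW (rep W).
  by move=> WWW; rewrite orbit_repE; have [] := WWe W (elt W)^-1%g WWW.
have /choice [N NP] : forall B, exists N : nat, WW B ->
    forall VV, finite_open_cover VV ->
    exists UU lam, stabilizer_ltc B e T L K' N VV UU lam.
  move=> B; have [WB|nWB] := pselect (WW B); last by exists 0%N.
  have [H FH HB] := WWst B WB.
  by have [N NP] := stabilizer_ltcP HB fT fL cK' (ltcF H FH); exists N.
pose BB := rep @` W0.
(* Only finitely many orbits occur, so their cardinality bounds have a maximum, fixed before [VV] is
   given. *)
have [M NM] : exists M, forall B, BB B -> (N B <= M)%N.
  have /finite_seqP [r BBr] : finite_set BB by exact: finite_image.
  exists (\max_(B <- r) N B)%N => B; rewrite BBr /= => Br.
  exact: leq_bigmax_seq.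
have /finite_seqP [s Ts] := fT.
exists (size s * M)%N => VV cVV.
(* Cutting by the interior of [C] confines the pieces to a compact set without losing the translates
   of [K]. *)
have [|C cC KC] := @compact_sub_interior X (\bigcup_(l in L) alpha l @` K) lcX.
  exact: compact_bigcup_act.
have [SS cSS starSS] := compact_star_refinement lcX hX cC cVV.
(* Members of [VH] stay small for [SS] after translation by any representative in [T]. *)
have [|VH cVH VHr] := @common_refinement X _ T
    (fun t => [set alpha t @^-1` S | S in SS]) fT.
  move=> t _; have [fS oS cS] := cSS; split; first exact: finite_image.
    move=> _ [S /oS oS' <-].
    by move: (@act_continuous _ _ alpha t) => /continuousP; exact.
  rewrite -subTset => x _.
  have [S SSS Sx] : (\bigcup_(S in SS) S) (alpha t x) by rewrite cS.
  by exists (alpha t @^-1` S) => //; exists S.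
have /choice [p pP] : forall B, exists p : set (set X) * (set X -> X -> X),
    WW B -> stabilizer_ltc B e T L K' (N B) VH p.1 p.2.
  move=> B; have [WB|nWB] := pselect (WW B); last by exists (set0, fun=> id).
  by have [UU [lam H]] := NP B WB VH cVH; exists (UU, lam).
pose D := [set q : set GX * set X | BB q.1 /\ (p q.1).1 q.2].
pose pc (q : set GX * set X) := piece alpha W1 L C° q.1 q.2.
pose pm (q : set GX * set X) := piece_map alpha W1 q.1 ((p q.1).2 q.2).
(* Distinct pairs may give the same piece, while the map may depend on the set only; [sel] fixes one
   pair per set. *)
pose sel U := xget (set0, set0) (D `&` pc @^-1` [set U]).
have selP U : (pc @` D) U -> exists q, [/\ D q, sel U = q & U = pc q].
  move=> [q Dq qU]; exists (sel U).
  by have [Ds /esym sU] := @xgetPex _ (set0, set0) (D `&` pc @^-1` [set U])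
    (ex_intro _ q (conj Dq qU)).
have DW q : D q -> WW q.1 by move=> [[W /W0s/repW WW_ <-] _].
have T1 : elt @` W1 `<=` T by move=> _ [W W1_ <-]; exists W => //; right.
exists (pc @` D), (fun U => pm (sel U)); split.
- move=> U /selP [q [Dq -> ->]].
  have [/(_ _ Dq.2) [oq lq] _ _ _] := pP _ (DW _ Dq); split.
    by apply: (@open_piece _ _ _ WW) => //; exact: open_interior.
  exact: (@locally_constant_piece _ _ _ WW).
- move=> x Kx; have [W WW_ Wx] := KW0 x Kx.
  have [] := pP (rep W) (repW _ (W0s _ WW_)) => _ pL _ _.
  pose x0 := alpha (elt W)^-1%g x.
  pose h l := ((elt (Dl l @` W))^-1 * l * elt W)%g.
  have W1l l : L l -> W1 (Dl l @` W) by move=> Ll; exists l => //; exists W.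
  have [| |V pV LV] := pL x0 h.
  + by exists (elt W); [exists W => //; left|exists x].
  + move=> l Ll; split.
      by apply: orbit_elt_stabilizer; rewrite ?orbit_rep_Delta.
    exists (elt (Dl l @` W)).
      by apply: T1; exists (Dl l @` W) => //; exact: W1l.
    by exists (elt W) => //; exists W => //; left.
  exists (pc (rep W, V)).
    by exists (rep W, V) => //; split=> //; exists W.
  move=> _ [l Ll <-]; split; first by apply: KC; exists l => //; exists x.
  exists (Dl l @` W); split; first exact: W1l.
  + by rewrite orbit_rep_Delta.
  + split=> [|l' Ll']; apply/Delta_imageE; rewrite actK.
      by rewrite mul1g; apply: Wx; left.
    by apply: Wx; right; exists l' => //; exists l.
  + by have := LV l Ll; rewrite /h /x0 -!actM mulgK.
- rewrite prednK//; apply/mult_leP => z.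
  (* At most [d.+1] members of [WW] contain [(1, z)], each contributing at most [e.+1] sets through
     the pulled-back point. *)
  have [r rd rW] := WWm (1%g, z).
  have /choice [t tP] : forall W, exists t : seq (set X),
      WW W -> (size t <= e.+1)%N /\
        forall V, (p (rep W)).1 V -> V (alpha (elt W)^-1%g z) -> V \in t.
    move=> W; have [WWW|nWW] := pselect (WW W); last by exists [::].
    have [_ _ /(_ (alpha (elt W)^-1%g z)) [t te tV] _] := pP _ (repW _ WWW).
    by exists t.
  exists [seq pc (rep W, V) | W <- [seq W <- r | `[< WW W >]], V <- t W].
    apply: size_allpairs_dep_leq.
      by rewrite size_filter (leq_trans (count_size _ _)).
    by move=> W; rewrite mem_filter => /andP[/asboolP /tP []].
  move=> _ [[B V] [/= BB_ pV] <-] [_ [W [/W1s WWW rWB [Wz _] Vz]]].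
  apply/allpairsPdep; exists W, V; split.
  + by rewrite mem_filter; apply/andP; split; [exact/asboolP|exact: rW].
  + by have [_] := tP W WWW; apply; rewrite ?rWB.
  + by rewrite rWB.
split.
- move=> U x l UU_; have [q [Dq -> ->]] := selP U UU_ => qx Ll qlx.
  have [_ _ _ [pE _ _]] := pP _ (DW _ Dq).
  apply: (@piece_map_equivariant _ _ _ WW _ _ _ L C° _ q.2) => // h y Bh.
  move=> [W W1_ [W' W1' hE]]; apply: (pE _ l) => //; first exact: Dq.2.
  split=> //; exists (elt W'); first by apply: T1; exists W'.
  by exists (elt W) => //; apply: T1; exists W.
- move=> U y UU_; have [q [Dq -> UE]] := selP U UU_.
  have [_ _ _ [_ pT _]] := pP _ (DW _ Dq).
  have small x : U x -> exists2 Q, SS Q & Q x /\ Q (pm q x).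
    rewrite UE => qx.
    apply: (@piece_map_small _ _ _ WW _ _ _ L C° _ q.2 _ VH) => //.
      by move=> v; apply: pT; exact: Dq.2.
    move=> S g VHS /T1 Tg; have [_ [Q SSQ <-] SQ] := VHr S g VHS Tg.
    by exists Q.
  have UC : U `<=` C by rewrite UE => x [/interior_subset].
  (* Each point of the fibre over [y] shares with [y] a member of [SS] meeting [C], so the star of
     [y] contains the fibre. *)
  move=> [x0 Ux0 x0y]; have [Q0 SSQ0 [Q0x0 Q0y]] := small x0 Ux0.
  rewrite x0y in Q0y.
  have [|V VVV VQ] := starSS Q0 y SSQ0 Q0y.
    by exists x0; split=> //; exact: UC.
  exists V => // x [[Ux xy]|->].
    have [Q SSQ [Qx Qy]] := small x Ux; apply: (VQ Q) => //.
      by rewrite -xy.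
    by exists x; split=> //; exact: UC.
  by apply: (VQ Q0) => //; exists x0; split=> //; exact: UC.
- move=> U UU_; have [q [Dq -> ->]] := selP U UU_.
  have [_ _ _ [_ _ pN]] := pP _ (DW _ Dq).
  apply: (@card_piece_map _ _ _ WW) => //; first by rewrite -Ts.
  apply: (card_le_trans (pN _ Dq.2)); rewrite card_le_II; apply: NM.
  exact: Dq.1.
Qed.
End StabilizerCovers.

(** * Monotonicity of admissibility and the inequality in the extended reals *)

Lemma ltc_admissible_le (R : realType) (G : groupType) (X : topologicalType)
    (alpha : action G X) d e :
  (d <= e)%N -> ltc_admissible alpha R d -> ltc_admissible alpha R e.
Proof.
move=> de ad L K fL cK; have [N ltcN] := ad L K fL cK.
exists N => VV /ltcN [UU [lam [UUo UUL UUm UUr]]]; exists UU, lam; split=> //.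
by apply: (le_trans UUm); rewrite lee_fin ler_nat.
Qed.

Local Open Scope ereal_scope.

Lemma dimLTC_ge0 (R : realType) (G : groupType) (X : topologicalType)
    (alpha : action G X) : 0 <= dimLTC alpha R.
Proof. by apply/ereal_infP => _ [n _ <-]; rewrite lee_fin ler0n. Qed.

Theorem theorem9p7 (R : realType) (G : groupType) (X : topologicalType)
    (alpha : action G X) (F : set (subgroup G))
    (lcX : locally_compact [set: X]) (hausX : hausdorff_space X)
    (F_nonempty : F !=set0)
    (F_conj : closed_under_conjugation F)
    (F_sub : closed_under_subgroups F) :
  dimLTC alpha R + 1 <=
    (eqasdim alpha F R + 1) *
      ereal_sup [set dimLTC (restrict_action alpha H) R + 1 | H in F].
Proof.
set S := ereal_sup _.
have SH H : F H -> dimLTC (restrict_action alpha H) R + 1 <= S.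
  by move=> FH; apply: ereal_sup_ubound; exists H.
have S1 : 1 <= S.
  have [H /SH] := F_nonempty; apply: le_trans.
  by rewrite leeDr// dimLTC_ge0.
have S0 : 0 < S by exact: lt_le_trans S1.
rewrite /eqasdim.
have [->|[d ad ->]] := ereal_inf_nat R (eqasdim_admissible alpha F R).
  by rewrite gt0_mulye// leey.
rewrite -EFinD natr1.
have [sE|Sfin] := eqVneq S +oo.
  by rewrite sE gt0_muley ?leey// lte_fin ltr0n.
have [s sE] : exists s, S = s%:E.
  by move: S0 Sfin; case: S {SH S1} => // s _ _; exists s.
rewrite sE in SH S1 S0 *.
(* The integer part of [s] still bounds every integer [e.+1 <= s]; it is positive since [1 <= s], so
   its predecessor is a genuine one. *)
have s1 : (0 < Num.truncn s)%N by rewrite truncn_gt0 -lee_fin.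
have ltcF H : F H ->
    ltc_admissible (restrict_action alpha H) R (Num.truncn s).-1.
  move=> FH; have := SH H FH; rewrite /dimLTC.
  have [->|[e ae ->]] :=
    ereal_inf_nat R (ltc_admissible (restrict_action alpha H) R).
    by rewrite leNgt ltry.
  rewrite -EFinD natr1 lee_fin => es; apply: ltc_admissible_le ae.
  by rewrite -ltnS prednK// truncn_gt_nat.
have := ltc_admissible_mul lcX hausX F_nonempty ad ltcF.
rewrite prednK// => adm.
apply: (@le_trans _ _ (((d.+1 * Num.truncn s).-1)%:R%:E + 1)).
  by rewrite leeD2r//; apply: ereal_inf_lbound; eexists; first exact: adm.
rewrite -EFinD natr1 prednK ?muln_gt0//.
rewrite -EFinM lee_fin natrM ler_wpM2l//.
by rewrite truncn_le -lee_fin ltW.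
Qed.
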